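(* Let $\mathbf A = \langle A, \to, 0 \rangle$ be an implicator groupoid, let $A'' = \{a'' \mid a \in A\}$ and $\mathbf{A''} = \langle A'', \to, 0\rangle$. Then: (a) $\langle A'', \to, 0 \rangle \in \mathcal{I}_{2,0}$; (b) $\mathbf A \models (x'' \to y'') \to x'' \approx x''$ if and only if $\mathbf{A''}$ is a De Morgan algebra; (c) $\mathbf A \models (y'' \to y'') \to (x'' \to x'') \approx x'' \to x''$ if and only if $\mathbf{A''}$ is a Kleene algebra; (d) $\mathbf A \models x'' \to x'' \approx 0'$ if and only if $\mathbf{A''}$ is a Boolean algebra.
   Context: An implicator groupoid is an algebra $\mathbf A = \langle A, \to, 0 \rangle$, with $\to$ binary and $0$ a constant, which, writing $x' := x \to 0$, satisfies the identities (I) $(x \to y) \to z \approx [(z' \to x) \to (y \to z)']'$ and (I$_0$) $0'' \approx 0$. $\mathcal{I}_{2,0}$ is the variety of implicator groupoids satisfying $x'' \approx x$. For an implicator groupoid $\mathbf{A}$, the set $A''$ is closed under $\to$ and contains $0$, so $\mathbf{A''}$ (with the restricted operations) is a subalgebra of $\mathbf{A}$. Following the paper, an implicator groupoid is called a De Morgan algebra if it satisfies $(x \to y) \to x \approx x$; a De Morgan algebra is a Kleene algebra if it satisfies either of the identities (equivalent for De Morgan algebras) (KL$_1$) $(x \to x) \to (y \to y)' \approx x \to x$ or (KL$_2$) $(y \to y) \to (x \to x) \approx x \to x$; a De Morgan algebra is a Boolean algebra if it satisfies $x \to x \approx 0'$. *)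

(* Defs.v *)
(* Algebras of type (2, 0). *)
Record algebra : Type := Algebra {
  carrier :> Type;
  imp : carrier -> carrier -> carrier;
  zero : carrier
}.

Arguments imp {_} _ _.
Arguments zero {_}.

Declare Scope implicator_scope.
Open Scope implicator_scope.

Definition neg {A : algebra} (x : A) : A := imp x zero.

Notation "x --> y" := (imp x y)
  (at level 55, right associativity) : implicator_scope.
Notation "x ^'" := (neg x)
  (at level 2, left associativity, format "x ^'") : implicator_scope.

Definition implicator_groupoid (A : algebra) : Prop :=
  (forall x y z : A,
     (x --> y) --> z = ((z^' --> x) --> (y --> z)^')^') /\
  (zero : A)^'^' = zero.

(* The variety I_{2,0}. *)
Definition I20 (A : algebra) : Prop :=
  implicator_groupoid A /\ forall x : A, x^'^' = x.

Definition de_morgan_algebra (A : algebra) : Prop :=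
  implicator_groupoid A /\ forall x y : A, (x --> y) --> x = x.

Definition KL1 (A : algebra) : Prop :=
  forall x y : A, (x --> x) --> (y --> y)^' = x --> x.

Definition KL2 (A : algebra) : Prop :=
  forall x y : A, (y --> y) --> (x --> x) = x --> x.

(* KL1 and KL2 are not interchangeable here: in a De Morgan algebra KL1 already
   gives 0 = 0', so only the trivial algebra satisfies it.  The disjunction
   therefore defines the same class as KL2 alone. *)
Definition kleene_algebra (A : algebra) : Prop :=
  de_morgan_algebra A /\ (KL1 A \/ KL2 A).

Definition boolean_algebra (A : algebra) : Prop :=
  de_morgan_algebra A /\ forall x : A, x --> x = zero^'.

Definition subalgebra (A : algebra) (S : A -> Prop)
    (S_imp : forall x y : A, S x -> S y -> S (x --> y)) (S_zero : S zero) :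
    algebra :=
  Algebra {x : A | S x}
    (fun u v => exist S (proj1_sig u --> proj1_sig v)
                  (S_imp _ _ (proj2_sig u) (proj2_sig v)))
    (exist S zero S_zero).

Definition dneg_set (A : algebra) (b : A) : Prop := exists a : A, b = a^'^'.

Lemma imp_imp_dneg (A : algebra) (hA : implicator_groupoid A) (x y z : A) :
  dneg_set A ((x --> y) --> z).
Proof.
destruct hA as [hI _].
rewrite (hI x y z), (hI (z^') x ((y --> z)^')).
unfold dneg_set; eexists; reflexivity.
Qed.

Lemma dneg_set_imp (A : algebra) (hA : implicator_groupoid A) (x y : A) :
  dneg_set A x -> dneg_set A y -> dneg_set A (x --> y).
Proof.
intros [a ->] _.
exact (imp_imp_dneg A hA (a^') zero y).
Qed.

Lemma dneg_set_zero (A : algebra) (hA : implicator_groupoid A) :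
  dneg_set A zero.
Proof. exists zero; symmetry; exact (proj2 hA). Qed.

Definition dneg_algebra (A : algebra) (hA : implicator_groupoid A) : algebra :=
  subalgebra A (dneg_set A) (dneg_set_imp A hA) (dneg_set_zero A hA).

(* Main.v *)
From Stdlib Require Import ProofIrrelevance Setoid.
Require Import Defs.

(** Two equational facts carry the theorem.

    The first is that [x'''' = x''] in every implicator groupoid
    ([dneg_dneg]), which makes double negation the identity on [A''].  The
    identity (I) with [0] for two of its variables gives
    [(0' --> x)'' = x''], hence [x'''' = (0' --> x'')''].  With one [0] it
    gives [(x --> y)' = ((0' --> x) --> y'')']: a negated implication hardly
    distinguishes [y] from [y''], the only trace being the prefix [0' -->] on
    the left.  So the point is that this prefix can be erased; (I) permutes the
    arguments of a nested implication, which carries erasability from one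
    position to the next until it reaches that one ([erase_left]).

    The second is that (KL2) forces [(x --> y) --> x = x] in [I_{2,0}]
    ([KL2_de_morgan]), so that the identities in (c) and (d), which do not
    mention the De Morgan law, nevertheless imply it.  In [I_{2,0}] one has
    [(x --> y) --> x = (0 --> y) --> x] and [0' --> x = x], so the law reduces
    to [0 --> y = 0'].  From (KL2) one gets [0 --> (u --> u) = 0'] for all [u]
    and also, more surprisingly, [u --> u = u] for [u := 0 --> y].  As
    [0 --> u = u] for this [u], it follows that [u = 0'].  The Boolean identity
    [x --> x = 0'] turns both sides of (KL2) into [0'].

    The rest is transport: an identity holds in [A''] exactly when it holds in
    [A] after [x''] is substituted for each variable [x]. *)

(** * Double negation in implicator groupoids *)

Lemma neg_imp (A : algebra) (hA : implicator_groupoid A) (x y : A) :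
  (x --> y)^' = ((zero^' --> x) --> y^'^')^'.
Proof. exact (proj1 hA x y zero). Qed.

Lemma dneg_erase (A : algebra) (hA : implicator_groupoid A) (x : A) :
  (zero^' --> x)^'^' = x^'^'.
Proof.
symmetry; transitivity (((zero^' --> x) --> (zero : A)^'^')^').
- exact (neg_imp A hA x zero).
- rewrite (proj2 hA); reflexivity.
Qed.

Lemma neg_erase_right (A : algebra) (hA : implicator_groupoid A) (x y : A) :
  (x --> (zero^' --> y))^' = (x --> y)^'.
Proof.
rewrite (neg_imp A hA x (zero^' --> y)), (dneg_erase A hA y).
symmetry; exact (neg_imp A hA x y).
Qed.

Lemma neg_erase_right_neg (A : algebra) (hA : implicator_groupoid A)
    (x y : A) :
  (x --> (zero^' --> y)^')^' = (x --> y^')^'.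
Proof.
rewrite (neg_imp A hA x ((zero^' --> y)^')), (dneg_erase A hA y).
symmetry; exact (neg_imp A hA x (y^')).
Qed.

(** (I) turns the right argument [z'] into [z''] on one side and into the end
    of a negated implication on the other, two places where erasure is already
    available. *)
Lemma erase_right_neg (A : algebra) (hA : implicator_groupoid A)
    (x y z : A) :
  (x --> y) --> (zero^' --> z)^' = (x --> y) --> z^'.
Proof.
rewrite (proj1 hA x y ((zero^' --> z)^')), (proj1 hA x y (z^')).
rewrite (dneg_erase A hA z), (neg_erase_right_neg A hA y z).
reflexivity.
Qed.

Lemma erase_left_neg (A : algebra) (hA : implicator_groupoid A)
    (x y z : A) :
  ((zero^' --> x)^' --> y) --> z = (x^' --> y) --> z.
Proof.
rewrite (proj1 hA ((zero^' --> x)^') y z), (proj1 hA (x^') y z).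
(* [z'] is itself the implication [z --> 0], so the left factor has the shape
   required for erasure on the right. *)
change (z^' --> (zero^' --> x)^') with ((z --> zero) --> (zero^' --> x)^').
rewrite (erase_right_neg A hA z zero x); reflexivity.
Qed.

Lemma erase_right (A : algebra) (hA : implicator_groupoid A) (x y z : A) :
  (x --> y) --> (zero^' --> z) = (x --> y) --> z.
Proof.
rewrite (proj1 hA x y (zero^' --> z)), (proj1 hA x y z).
rewrite (erase_left_neg A hA z x), (neg_erase_right A hA y z).
reflexivity.
Qed.

Lemma erase_left (A : algebra) (hA : implicator_groupoid A) (x y z : A) :
  ((zero^' --> x) --> y) --> z = (x --> y) --> z.
Proof.
rewrite (proj1 hA (zero^' --> x) y z), (proj1 hA x y z).
change (z^' --> (zero^' --> x)) with ((z --> zero) --> (zero^' --> x)).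
rewrite (erase_right A hA z zero x); reflexivity.
Qed.

Lemma neg_imp_dneg (A : algebra) (hA : implicator_groupoid A) (x y : A) :
  (x --> y^'^')^' = (x --> y)^'.
Proof.
rewrite (neg_imp A hA x y).
symmetry; exact (erase_left A hA x (y^'^') zero).
Qed.

(** The prefix [0' -->] exposes the inner double negation as the right argument
    of a negated implication, where it disappears. *)
Lemma dneg_dneg (A : algebra) (hA : implicator_groupoid A) (x : A) :
  x^'^'^'^' = x^'^'.
Proof.
rewrite <- (dneg_erase A hA (x^'^')), (neg_imp_dneg A hA (zero^') x).
exact (dneg_erase A hA x).
Qed.

(** * Involutive implicator groupoids *)

Lemma imp_unit_left (A : algebra) (hA : I20 A) (x : A) : zero^' --> x = x.
Proof.
destruct hA as [hG inv].
rewrite <- (inv (zero^' --> x)), (dneg_erase A hG x); apply inv.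
Qed.

Lemma neg_imp_neg_imp (A : algebra) (hA : I20 A) (x y : A) :
  (x --> (y --> x)^')^' = (zero --> y) --> x.
Proof.
destruct hA as [[hI h0] inv].
rewrite (hI zero y x).
change (x^' --> zero) with (x^'^').
rewrite inv; reflexivity.
Qed.

Lemma imp_zero_left_imp_unit (A : algebra) (hA : I20 A) (x : A) :
  (zero --> x) --> zero^' = x --> zero^'.
Proof.
rewrite <- (neg_imp_neg_imp A hA (zero^') x), (imp_unit_left A hA).
apply (proj2 hA).
Qed.

Lemma zero_imp_unit (A : algebra) (hA : I20 A) :
  (zero : A) --> zero^' = zero^'.
Proof.
(* [0' = 0 --> 0] is itself of the form [0 --> x]. *)
transitivity ((zero : A)^' --> zero^').
- symmetry; exact (imp_zero_left_imp_unit A hA zero).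
- exact (imp_unit_left A hA (zero^')).
Qed.

Lemma imp_unit_eq_zero_imp (A : algebra) (hA : I20 A) (x : A) :
  x --> zero^' = zero --> x^'.
Proof.
pose proof hA as [[hI h0] inv].
enough (H : forall y : A, y^' --> zero^' = zero --> y).
{ rewrite <- (inv x) at 1; apply H. }
intro y; change (y^' --> zero^') with ((y --> zero) --> zero^').
rewrite (hI y zero (zero^')), (zero_imp_unit A hA), h0.
exact (inv (zero --> y)).
Qed.

(** The operation [x |-> 0 --> x] measures how far the algebra is from being
    De Morgan, where it is constantly [0'].  Up to negation it is idempotent,
    because [x] and [0 --> x] agree on the left of [0']. *)
Lemma zero_imp_neg_zero_imp (A : algebra) (hA : I20 A) (x : A) :
  zero --> (zero --> x)^' = zero --> x^'.
Proof.
rewrite <- !(imp_unit_eq_zero_imp A hA).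
exact (imp_zero_left_imp_unit A hA x).
Qed.

Lemma zero_imp_zero_imp (A : algebra) (hA : I20 A) (x : A) :
  zero --> (zero --> x) = zero --> x.
Proof.
pose proof hA as [_ inv].
enough (H : forall y : A, zero --> (zero --> y^') = zero --> y^').
{ rewrite <- (inv x); apply H. }
intro y.
rewrite <- (inv (zero --> y^')) at 1.
(* [0 --> u'] equals [0 --> (0 --> u)']; for [u := (0 --> y')'] the inner term
   is one to which the same equation applies again. *)
rewrite <- (zero_imp_neg_zero_imp A hA ((zero --> y^')^')).
rewrite (zero_imp_neg_zero_imp A hA (y^')), inv.
apply (zero_imp_neg_zero_imp A hA).
Qed.

Lemma neg_imp_self (A : algebra) (hA : I20 A) (x : A) : x^' --> x = x.
Proof.
pose proof hA as [_ inv].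
enough (H : forall y : A, y --> y^' = y^').
{ transitivity (x^' --> x^'^').
  - rewrite inv; reflexivity.
  - rewrite H; apply inv. }
intro y; rewrite <- (inv (y --> y^')).
(* Reading [y'] as [(0' --> y)'] on the right gives the shape [y --> (0' --> y)']. *)
rewrite <- (imp_unit_left A hA y) at 2.
rewrite (neg_imp_neg_imp A hA y (zero^')), (zero_imp_unit A hA).
rewrite (imp_unit_left A hA); reflexivity.
Qed.

(** On the left of [--> x], the term [x --> y] depends on [y] only through
    [0 --> y]; this reduces the De Morgan law to [0 --> y = 0']. *)
Lemma imp_imp_self (A : algebra) (hA : I20 A) (x y : A) :
  (x --> y) --> x = (zero --> y) --> x.
Proof.
rewrite (proj1 (proj1 hA) x y x), (neg_imp_self A hA).
apply (neg_imp_neg_imp A hA).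
Qed.

Lemma zero_imp_imp_imp (A : algebra) (hA : I20 A) (x y : A) :
  (zero --> (x --> y)) --> x = (zero --> y) --> x.
Proof.
rewrite <- (neg_imp_neg_imp A hA x (x --> y)), (imp_imp_self A hA x y).
rewrite (neg_imp_neg_imp A hA), (zero_imp_zero_imp A hA); reflexivity.
Qed.

(** * The Kleene and Boolean identities imply the De Morgan law *)

Lemma KL2_zero_imp_self_imp (A : algebra) (hA : I20 A) (hK : KL2 A) (x : A) :
  zero --> (x --> x) = zero^'.
Proof.
assert (H : zero --> (x --> x)^' = zero^').
{ rewrite <- (imp_unit_eq_zero_imp A hA).
  (* (KL2) at the pair [0, x], since [0' = 0 --> 0]. *)
  exact (hK zero x). }
rewrite <- (proj2 hA (x --> x)), <- (zero_imp_neg_zero_imp A hA), H.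
rewrite (proj2 (proj1 hA)); reflexivity.
Qed.

Lemma KL2_zero_imp (A : algebra) (hA : I20 A) (hK : KL2 A) (x : A) :
  zero --> x = zero^'.
Proof.
assert (fixed : forall y : A, (zero --> y) --> y = y).
{ intro y; rewrite <- (zero_imp_imp_imp A hA y y).
  rewrite (KL2_zero_imp_self_imp A hA hK).
  apply (imp_unit_left A hA). }
(* As [0 --> u = u] for [u := 0 --> x], the equation [fixed] at [u] reads
   [u --> u = u]. *)
assert (idem : (zero --> x) --> (zero --> x) = zero --> x).
{ rewrite <- (zero_imp_zero_imp A hA x) at 1; apply fixed. }
rewrite <- (KL2_zero_imp_self_imp A hA hK (zero --> x)), idem.
symmetry; apply (zero_imp_zero_imp A hA).
Qed.

Lemma KL2_de_morgan (A : algebra) (hA : I20 A) (hK : KL2 A) :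
  de_morgan_algebra A.
Proof.
split; [exact (proj1 hA) |].
intros x y; rewrite (imp_imp_self A hA), (KL2_zero_imp A hA hK).
apply (imp_unit_left A hA).
Qed.

(** (KL1) is a degenerate alternative: at [x = 0] it reads [(y --> y)' = 0'], so
    that every [y --> y] equals [0] and (KL2) reduces to [0 = 0]. *)
Lemma kleene_KL2 (A : algebra) (hA : I20 A) : kleene_algebra A -> KL2 A.
Proof.
intros [_ [h1 | h2]]; [| exact h2].
pose proof hA as [[_ h0] inv].
assert (e : forall y : A, (y --> y)^' = zero^').
{ intro y; rewrite <- (imp_unit_left A hA ((y --> y)^')); exact (h1 zero y). }
assert (s : forall y : A, y --> y = zero).
{ intro y; rewrite <- (inv (y --> y)), e; exact h0. }
intros x y; rewrite !s; reflexivity.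
Qed.

Lemma kleene_iff_KL2 (A : algebra) (hA : I20 A) : kleene_algebra A <-> KL2 A.
Proof.
split; [exact (kleene_KL2 A hA) |].
intro hK; split; [exact (KL2_de_morgan A hA hK) | right; exact hK].
Qed.

Lemma boolean_iff_imp_self (A : algebra) (hA : I20 A) :
  boolean_algebra A <-> forall x : A, x --> x = zero^'.
Proof.
split; [exact (@proj2 _ _) |].
intro hB; split; [apply (KL2_de_morgan A hA) | exact hB].
intros x y; rewrite !hB; reflexivity.
Qed.

(** * Transport between [A] and [A''] *)

Lemma subalgebra_ext (A : algebra) (S : A -> Prop) S_imp S_zero
    (u v : subalgebra A S S_imp S_zero) :
  proj1_sig u = proj1_sig v -> u = v.
Proof.
destruct u as [x hx], v as [y hy]; simpl; intros <-.
f_equal; apply proof_irrelevance.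
Qed.

Lemma subalgebra_implicator_groupoid (A : algebra) (S : A -> Prop) S_imp S_zero :
  implicator_groupoid A ->
  implicator_groupoid (subalgebra A S S_imp S_zero).
Proof.
intros [hI h0]; split.
- intros x y z; apply subalgebra_ext.
  exact (hI (proj1_sig x) (proj1_sig y) (proj1_sig z)).
- apply subalgebra_ext; exact h0.
Qed.

Definition dneg_elt (A : algebra) (hA : implicator_groupoid A) (a : A) :
    dneg_algebra A hA :=
  exist (dneg_set A) (a^'^') (ex_intro _ a eq_refl).

Lemma dneg_elt_surj (A : algebra) (hA : implicator_groupoid A)
    (u : dneg_algebra A hA) :
  exists a : A, u = dneg_elt A hA a.
Proof.
destruct u as [x [a e]]; exists a; apply subalgebra_ext; exact e.
Qed.

Lemma dneg_algebra_I20 (A : algebra) (hA : implicator_groupoid A) :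
  I20 (dneg_algebra A hA).
Proof.
split; [apply subalgebra_implicator_groupoid; exact hA |].
intro u; destruct (dneg_elt_surj A hA u) as [a ->].
apply subalgebra_ext; exact (dneg_dneg A hA a).
Qed.

Theorem theorem4p2 :
  forall (A : algebra) (hA : implicator_groupoid A),
    I20 (dneg_algebra A hA) /\
    ((forall x y : A, (x^'^' --> y^'^') --> x^'^' = x^'^') <->
     de_morgan_algebra (dneg_algebra A hA)) /\
    ((forall x y : A,
        (y^'^' --> y^'^') --> (x^'^' --> x^'^') = x^'^' --> x^'^') <->
     kleene_algebra (dneg_algebra A hA)) /\
    ((forall x : A, x^'^' --> x^'^' = (zero : A)^') <->
     boolean_algebra (dneg_algebra A hA)).
Proof.
intros A hA.
pose proof (dneg_algebra_I20 A hA) as hB.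
split; [exact hB |].
split; [| split].
- split.
  + intro h; split; [exact (proj1 hB) |].
    intros u v.
    destruct (dneg_elt_surj A hA u) as [x ->].
    destruct (dneg_elt_surj A hA v) as [y ->].
    apply subalgebra_ext; exact (h x y).
  + intros [_ h] x y.
    exact (f_equal (@proj1_sig _ _) (h (dneg_elt A hA x) (dneg_elt A hA y))).
- rewrite (kleene_iff_KL2 _ hB); split.
  + intros h u v.
    destruct (dneg_elt_surj A hA u) as [x ->].
    destruct (dneg_elt_surj A hA v) as [y ->].
    apply subalgebra_ext; exact (h x y).
  + intros h x y.
    exact (f_equal (@proj1_sig _ _) (h (dneg_elt A hA x) (dneg_elt A hA y))).
- rewrite (boolean_iff_imp_self _ hB); split.
  + intros h u.
    destruct (dneg_elt_surj A hA u) as [x ->].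
    apply subalgebra_ext; exact (h x).
  + intros h x.
    exact (f_equal (@proj1_sig _ _) (h (dneg_elt A hA x))).
Qed.
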